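(* Consider the problem of minimizing $\varphi(x)$ over $x\in\mathbb{R}^n$ subject to $f(x)\in\Theta$, where $\Theta\subset\mathbb{R}^m$ is closed and convex, and $\varphi:\mathbb{R}^n\to\mathbb{R}$ and $f:\mathbb{R}^n\to\mathbb{R}^m$ are twice differentiable at $\bar x$. Let $L(x,\lambda)=\varphi(x)+\langle\lambda,f(x)\rangle$ and $$\mathcal{L}(x,\lambda,\rho)=\varphi(x)+\tfrac{\rho}{2}\big[\operatorname{dist}(f(x)+\rho^{-1}\lambda;\Theta)^2-\|\rho^{-1}\lambda\|^2\big],\quad\rho>0.$$ Let $(\bar x,\bar\lambda)$ satisfy $\nabla_xL(\bar x,\bar\lambda)=0$, $\bar\lambda\in N_\Theta(f(\bar x))$. Assume that: - $\Theta$ is parabolically derivable at $f(\bar x)$ for every vector from $K_\Theta(f(\bar x),\bar\lambda)$; - $\Theta$ is parabolically regular at $f(\bar x)$ for $\bar\lambda$; - the second subderivative $\mathrm{d}^2\delta_\Theta(f(\bar x),\bar\lambda)$ is continuous relative to its domain, which is $K_\Theta(f(\bar x),\bar\lambda)$. Then the following are equivalent: (i) $\langle\nabla^2_{xx}L(\bar x,\bar\lambda)w,w\rangle+\mathrm{d}^2\delta_\Theta(f(\bar x),\bar\lambda)(\nabla f(\bar x)w)>0$ for all $w\in\mathbb{R}^n\setminus\{0\}$ satisfying $\nabla f(\bar x)w\in K_\Theta(f(\bar x),\bar\lambda)$. (ii) There exists $\bar\rho>0$ such that for any $\rho>\bar\rho$ we have $\mathrm{d}^2_x\mathcal{L}((\bar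 x,\bar\lambda,\rho),0)(w)>0$ whenever $w\in\mathbb{R}^n\setminus\{0\}$. (iii) There are $\bar\rho>0$, $\varepsilon>0$ and $\ell>0$ (all dependent on $\bar\lambda$) such that for any $\rho\ge\bar\rho$ we have $$\mathcal{L}(x,\bar\lambda,\rho)\ge\varphi(\bar x)+\tfrac{\ell}{2}\|x-\bar x\|^2\quad\text{whenever }x\in\mathbb{B}_\varepsilon(\bar x).$$
   Context: $\mathbb{B}_\varepsilon(\bar x)$ is the closed ball of radius $\varepsilon$ about $\bar x$; $\delta_\Theta$ is the indicator function of $\Theta$; $N_\Theta$ is the normal cone of convex analysis. Tangent cone: $T_\Theta(\bar y)=\{w:\exists t_k\downarrow0,\ w_k\to w,\ \bar y+t_kw_k\in\Theta\}$. Critical cone: $K_\Theta(\bar y,\bar\lambda)=T_\Theta(\bar y)\cap\{\bar\lambda\}^\perp$. Second-order tangent set: $T^2_\Theta(\bar y,w)=\{u:\exists t_k\downarrow0,\ u_k\to u,\ \bar y+t_kw+\tfrac12t_k^2u_k\in\Theta\}$. $\Theta$ is parabolically derivable at $\bar y$ for $w$ if $T^2_\Theta(\bar y,w)\ne\emptyset$ and for each $u\in T^2_\Theta(\bar y,w)$ there are $\varepsilon>0$ and an arc $\xi:[0,\varepsilon]\to\Theta$ with $\xi(0)=\bar y$, $\xi'_+(0)=w$ and $\xi''_+(0):=\lim_{t\downarrow0}\frac{\xi(t)-\xi(0)-t\xi'_+(0)}{\frac12t^2}=u$. Second-order difference quotients: $\Delta_t^2\psi(\bar x,\bar v)(u)=\frac{\psi(\bar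 x+tu)-\psi(\bar x)-t\langle\bar v,u\rangle}{\frac12t^2}$, $t>0$. Second subderivative: $\mathrm{d}^2\psi(\bar x,\bar v)(w)=\liminf_{t\downarrow0,\,u\to w}\Delta_t^2\psi(\bar x,\bar v)(u)$; its domain is the set where it is $<\infty$. $\mathrm{d}^2_x\mathcal{L}((\bar x,\bar\lambda,\rho),0)$ denotes the second subderivative of the function $x\mapsto\mathcal{L}(x,\bar\lambda,\rho)$ at $\bar x$ for $\bar v=0$. $\Theta$ is parabolically regular at $\bar y\in\Theta$ for $\bar\lambda$ if for every $w$ with $\mathrm{d}^2\delta_\Theta(\bar y,\bar\lambda)(w)<\infty$ there exist $t_k\downarrow0$, $w_k\to w$ with $\Delta^2_{t_k}\delta_\Theta(\bar y,\bar\lambda)(w_k)\to\mathrm{d}^2\delta_\Theta(\bar y,\bar\lambda)(w)$ and $\limsup_k\|w_k-w\|/t_k<\infty$. *)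

(* Defs.v *)
From HB Require Import structures.
From mathcomp Require Import all_boot all_order all_algebra.
From mathcomp Require Import ring lra.
From mathcomp Require Import all_classical all_reals all_analysis.

Set Implicit Arguments.
Unset Strict Implicit.
Unset Printing Implicit Defensive.

Import Order.TTheory GRing.Theory Num.Theory.
Import numFieldNormedType.Exports.

Local Open Scope classical_set_scope.
Local Open Scope ring_scope.

(** Vectors of R^n are row vectors ['rV[R]_n].  The library norm [`|x|] on them
    is the maximum norm: it induces the usual topology and notion of
    differentiability, but distances, balls and lengths need [enorm]. *)

Section Euclidean.
Context {R : realType} {n : nat}.
Implicit Types (u v x : 'rV[R]_n) (S : set 'rV[R]_n).

Definition dot u v : R := \sum_(i < n) u 0 i * v 0 i.

Definition enorm u : R := Num.sqrt (dot u u).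

Definition eball x (e : R) : set 'rV[R]_n := [set z | enorm (z - x) <= e].

Definition dist_to x S : R := inf [set enorm (x - z) | z in S].

End Euclidean.

Section Calculus.
Context {R : realType}.

Definition gradient n (phi : 'rV[R]_n -> R) (x : 'rV[R]_n) : 'rV[R]_n :=
  \row_(i < n) 'd (phi : 'rV[R]_n -> R^o) x (delta_mx 0 i).

Definition hessian n (phi : 'rV[R]_n -> R) (x : 'rV[R]_n) : 'M[R]_n :=
  'J (gradient phi) x.

Definition twice_differentiable_fun n (phi : 'rV[R]_n -> R) (x : 'rV[R]_n) :=
  (\forall z \near x, differentiable (phi : 'rV[R]_n -> R^o) z) /\
  differentiable (gradient phi) x.

Definition twice_differentiable_map n m (f : 'rV[R]_n -> 'rV[R]_m)
    (x : 'rV[R]_n) :=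
  (\forall z \near x, differentiable f z) /\
  differentiable (fun z => 'J f z) x.

(** [t_k] decreases to 0 in the sense of variational analysis: positive terms
    with limit 0, not necessarily monotone. *)
Definition down0 (t : R^nat) := (forall k, 0 < t k) /\ t @ \oo --> (0 : R).

End Calculus.

Section VariationalAnalysis.
Context {R : realType} {m : nat}.
Implicit Types (Theta : set 'rV[R]_m) (x y u v w lambda : 'rV[R]_m).
Implicit Types (psi : 'rV[R]_m -> \bar R).

Definition indic_fun Theta (z : 'rV[R]_m) : \bar R :=
  if `[< Theta z >] then 0%E else +oo%E.

Definition normal_cone Theta y : set 'rV[R]_m :=
  [set v | Theta y /\ forall z, Theta z -> dot v (z - y) <= 0].

Definition tangent_cone Theta y : set 'rV[R]_m :=
  [set w | exists (t : R^nat) (w_ : nat -> 'rV[R]_m),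
     [/\ down0 t, w_ @ \oo --> w & forall k, Theta (y + t k *: w_ k)]].

Definition critical_cone Theta y lambda : set 'rV[R]_m :=
  tangent_cone Theta y `&` [set w | dot lambda w = 0].

Definition second_tangent_set Theta y w : set 'rV[R]_m :=
  [set u | exists (t : R^nat) (u_ : nat -> 'rV[R]_m),
     [/\ down0 t, u_ @ \oo --> u &
       forall k, Theta (y + t k *: w + (2^-1 * t k ^+ 2) *: u_ k)]].

(** Only the values of [xi] on [[0, e]] matter. *)
Definition parabolically_derivable Theta y w :=
  second_tangent_set Theta y w !=set0 /\
  forall u, second_tangent_set Theta y w u ->
    exists (e : R) (xi : R -> 'rV[R]_m),
      [/\ 0 < e,
          (forall t, 0 <= t <= e -> Theta (xi t)),
          xi 0 = y,
          t^-1 *: (xi t - xi 0) @[t --> 0^'+] --> w &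
          (2^-1 * t ^+ 2)^-1 *: (xi t - xi 0 - t *: w) @[t --> 0^'+] --> u].

Definition second_quotient psi x v (t : R) u : \bar R :=
  ((psi (x + t *: u)%R - psi x - (t * dot v u)%:E) * ((2^-1 * t ^+ 2)^-1)%:E)%E.

Definition second_subderivative psi x v w : \bar R :=
  limf_einf (fun p : R * 'rV[R]_m => second_quotient psi x v p.1 p.2)
    (filter_prod (0^'+) (nbhs w)).

Definition domain psi : set 'rV[R]_m := [set w | (psi w < +oo)%E].

Definition parabolically_regular Theta y lambda :=
  let d2 := second_subderivative (indic_fun Theta) y lambda in
  forall w, domain d2 w ->
    exists (t : R^nat) (w_ : nat -> 'rV[R]_m),
      [/\ down0 t, w_ @ \oo --> w,
          second_quotient (indic_fun Theta) y lambda (t k) (w_ k)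
            @[k --> \oo] --> d2 w &
          (limn_esup (fun k => (enorm (w_ k - w) / t k)%:E) < +oo)%E].

Lemma dot_continuous (u : 'rV[R]_m) : continuous (fun v => dot u v).
Proof.
move=> v; rewrite /dot.
have addc : continuous (fun x : R * R => x.1 + x.2).
  by move=> x; apply: (@cvgD R R^o); [exact: cvg_fst|exact: cvg_snd].
apply: (cvg_big (op := +%R) addc (F := nbhs v)) => i _.
by apply: cvgM; [exact: cvg_cst|exact: coord_continuous].
Qed.

Lemma dotDr (u v w : 'rV[R]_m) : dot u (v + w) = dot u v + dot u w.
Proof.
by rewrite /dot -big_split/=; apply: eq_bigr => i _; rewrite mxE mulrDr.
Qed.

Lemma dotZr (a : R) (u v : 'rV[R]_m) : dot u (a *: v) = a * dot u v.
Proof.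
by rewrite /dot mulr_sumr; apply: eq_bigr => i _; rewrite mxE mulrCA.
Qed.

Lemma second_quotient_indic Theta y v (t : R) u : Theta y ->
  Theta (y + t *: u) ->
  second_quotient (indic_fun Theta) y v t u =
  (- (t * dot v u) / (2^-1 * t ^+ 2))%:E.
Proof.
move=> /asboolT Ty /asboolT Tu.
by rewrite /second_quotient /indic_fun Ty Tu sube0 add0e -EFinN -EFinM.
Qed.

Lemma second_quotient_indic_pinfty Theta y v (t : R) u : 0 < t -> Theta y ->
  ~ Theta (y + t *: u) ->
  second_quotient (indic_fun Theta) y v t u = +oo%E.
Proof.
move=> t0 /asboolT Ty /asboolF Tu.
rewrite /second_quotient /indic_fun Ty Tu sube0 addye//.
by rewrite gt0_mulye// lte_fin invr_gt0 mulr_gt0// ?invr_gt0// exprn_gt0.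
Qed.

(** This identity is why the continuity hypothesis of the theorem, stated
    relative to the domain, needs no separate assumption that the domain is the
    critical cone. *)
Lemma domain_second_subderivative_indic Theta y lambda :
  normal_cone Theta y lambda ->
  (forall w, critical_cone Theta y lambda w -> parabolically_derivable Theta y w) ->
  domain (second_subderivative (indic_fun Theta) y lambda) =
  critical_cone Theta y lambda.
Proof.
move=> [Ty Ny] pd; apply/seteqP; split => w; last first.
  move=> Kw; have [[u [t [u_ [[t0 tcvg] ucvg Tu]]]] _] := pd w Kw.
  case: Kw => _ /= lw; rewrite /domain/=.
  pose w_ k := w + (2^-1 * t k) *: u_ k.
  have wcvg : w_ @ \oo --> w.
    rewrite -[X in _ --> X]addr0; apply: cvgD; first exact: cvg_cst.
    rewrite -(scale0r u); apply: cvgZ => //.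
    by rewrite -(mulr0 2^-1); apply: cvgM => //; exact: cvg_cst.
  have Tw k : Theta (y + t k *: w_ k).
    by rewrite /w_ scalerDr scalerA addrA mulrCA -expr2.
  have qE k : second_quotient (indic_fun Theta) y lambda (t k) (w_ k) =
      (- dot lambda (u_ k))%:E.
    rewrite second_quotient_indic//; congr EFin.
    have tk0 : t k != 0 by rewrite gt_eqF.
    by rewrite /w_ dotDr lw add0r dotZr; field.
  have dcvg : dot lambda (u_ k) @[k --> \oo] --> dot lambda u.
    by apply: continuous_cvg => //; exact: dot_continuous.
  rewrite /second_subderivative limf_einfE.
  apply: (@le_lt_trans _ _ (1 - dot lambda u)%:E); last exact: ltry.
  apply: ge_ereal_sup => _ [V FV <-].
  have FN : (fun k => (t k, w_ k)) @ \oo `=>` filter_prod 0^'+ (nbhs w).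
    have tright : t @ \oo `=>` 0^'+.
      move=> A /= [e /= e0 eA]; move: tcvg => /cvgrPdist_lt /(_ e e0).
      by apply: filterS => k /= ?; exact: eA.
    exact: (cvg_pair tright wcvg).
  have [k [Vk dk]] : exists k, V (t k, w_ k) /\ dot lambda u - 1 < dot lambda (u_ k).
    have : \forall k \near \oo, V (t k, w_ k) /\ dot lambda u - 1 < dot lambda (u_ k).
      apply: filterI; first exact: FN.
      by apply: (cvgr_gt _ dcvg); rewrite ltrBlDr ltrDl.
    by move=> /filter_ex.
  apply: (@le_trans _ _ (second_quotient (indic_fun Theta) y lambda (t k) (w_ k))).
    by apply: ereal_inf_lbound; exists (t k, w_ k).
  by rewrite qE lee_fin; lra.
rewrite /domain/= => dw.
have [M dM] : exists M : R, (second_subderivative (indic_fun Theta) y lambda w < M%:E)%E.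
  move: dw; case: second_subderivative => // [r _|_]; last by exists 0; exact: ltNyr.
  by exists (r + 1); rewrite lte_fin ltrDl.
have /choice[p pP] : forall k : nat, exists p : R * 'rV[R]_m,
    [/\ 0 < p.1, p.1 < k.+1%:R^-1, ball w k.+1%:R^-1 p.2 &
     (second_quotient (indic_fun Theta) y lambda p.1 p.2 < M%:E)%E].
  move=> k; pose V : set (R * 'rV[R]_m) :=
    [set p | (0 < p.1 < k.+1%:R^-1) /\ ball w k.+1%:R^-1 p.2].
  have FV : filter_prod (0^'+) (nbhs w) V.
    exists ([set r : R | 0 < r < k.+1%:R^-1], ball w k.+1%:R^-1).
      split => /=; last exact: nbhsx_ballx.
      near=> r; apply/andP; split; first by near: r; exact: nbhs_right_gt.
      by near: r; apply: nbhs_right_lt; rewrite invr_gt0 ltr0n.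
    by move=> [a b] /= [].
  move: dM; rewrite /second_subderivative limf_einfE => dM.
  have : (ereal_inf ((fun p : R * 'rV[R]_m => second_quotient (indic_fun Theta) y lambda p.1 p.2) @` V) < M%:E)%E.
    by apply: le_lt_trans dM; apply: ereal_sup_ubound; exists V.
  by move=> /ereal_inf_lt[_ /= [q [/andP[q0 q1] bq] <-] qM]; exists q.
have Tp k : Theta (y + (p k).1 *: (p k).2).
  apply: contrapT => nT; have [p0 _ _] := pP k.
  by rewrite second_quotient_indic_pinfty.
have pcvg1 : (p k).1 @[k --> \oo] --> (0 : R).
  apply: (@squeeze_cvgr _ _ _ _ (fun=> 0) (fun k => k.+1%:R^-1)).
  - by near=> k; have [p0 p1 _ _] := pP k; rewrite (ltW p0) (ltW p1).
  - exact: cvg_cst.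
  - exact: cvg_harmonic.
have pcvg2 : (p k).2 @[k --> \oo] --> w.
  apply/cvg_ballP => e e0; near=> k.
  have [_ _ bk _] := pP k; apply: le_ball bk; apply: ltW.
  by near: k; exact: near_infty_natSinv_lt (PosNum e0).
split.
  exists (fun k => (p k).1), (fun k => (p k).2); split => //.
  by split => // k; have [] := pP k.
have dcvg : dot lambda (p k).2 @[k --> \oo] --> dot lambda w.
  by apply: continuous_cvg => //; exact: dot_continuous.
apply: (cvg_unique _ dcvg) => //.
apply: (@squeeze_cvgr _ _ _ _ (fun k => - (M / 2 * (p k).1)) (fun=> 0)).
- near=> k; have [p0 _ _] := pP k; rewrite second_quotient_indic// lte_fin.
  have := Ny _ (Tp k); rewrite addrAC subrr add0r dotZr pmulr_rle0// => d0.
  rewrite ltr_pdivrMr; last by rewrite mulr_gt0// ?invr_gt0// exprn_gt0.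
  move=> h; rewrite d0 andbT lerNl ltW//.
  by rewrite -(ltr_pM2l p0); move: h; rewrite expr2; lra.
- by rewrite -oppr0 -(mulr0 (M / 2)); apply: cvgN; apply: cvgM => //; exact: cvg_cst.
- exact: cvg_cst.
Unshelve. all: by end_near. Qed.

End VariationalAnalysis.

Section Lagrangians.
Context {R : realType} {n m : nat}.
Implicit Types (phi : 'rV[R]_n -> R) (f : 'rV[R]_n -> 'rV[R]_m).

Definition lagrangian phi f (x : 'rV[R]_n) (lambda : 'rV[R]_m) : R :=
  phi x + dot lambda (f x).

Definition aug_lagrangian phi f (Theta : set 'rV[R]_m)
    (x : 'rV[R]_n) (lambda : 'rV[R]_m) (rho : R) : R :=
  phi x + rho / 2 * (dist_to (f x + rho^-1 *: lambda) Theta ^+ 2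
                     - enorm (rho^-1 *: lambda) ^+ 2).

End Lagrangians.

(* Main.v *)
Require Import Defs.
From HB Require Import structures.
From mathcomp Require Import all_boot all_order all_algebra.
From mathcomp Require Import ring lra.
From mathcomp Require Import all_classical all_reals all_analysis.

Set Implicit Arguments.
Unset Strict Implicit.
Unset Printing Implicit Defensive.

Import Order.TTheory GRing.Theory Num.Theory.
Import numFieldNormedType.Exports.

Local Open Scope classical_set_scope.
Local Open Scope ring_scope.

(** Since [dist (f x + lambda / rho) Theta ^ 2] is an infimum over [s] in
    [Theta], completing the square gives
      aug (x, lambda, rho) =
        inf_s  L (x, lambda) - <lambda, s> + rho / 2 |f x - s| ^ 2,
    which is nondecreasing in [rho] and equals [phi xbar] at [xbar].  Write
    [v = (s - f xbar) / t] and [x = xbar + t w'].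

    (ii) => (i): taking [s = f xbar + t v] with [v] near [f'(xbar) w], the
    quadratic penalty is [o (t ^ 2)] by mere differentiability of [f], so
    [d2 aug (w) <= <D2 L w, w> + d2 delta_Theta (f'(xbar) w)].

    (i) => (iii): near a fixed unit vector [w], either [v] is near
    [f'(xbar) w] and the liminf defining the second subderivative of the
    indicator yields quadratic growth, or [v] stays away from it and the penalty
    [rho / 2 |f x - s| ^ 2] is at least a multiple of [rho t ^ 2], which wins
    for [rho] large.  Compactness of the unit sphere makes [t] and [rho]
    uniform. *)

(** * Small parameters and strict margins *)

Section Reals.
Context {R : realType}.

(** For [0 < k <= 1] it is enough to have [C * k <= e]; dividing by [C + 1] covers [C = 0]. *)
Lemma exists_small_sqr (C e : R) : 0 <= C -> 0 < e ->
  exists2 k, 0 < k & C * k ^+ 2 <= e.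
Proof.
move=> C0 e0; have C10 : 0 < C + 1 by rewrite ltr_wpDl.
exists (Num.min 1 (e / (C + 1))); first by rewrite lt_min ltr01 divr_gt0.
set k := Num.min _ _.
have k0 : 0 <= k by rewrite le_min ler01 divr_ge0 ?ltW.
have k1 : k <= 1 by rewrite ge_min lexx.
have ke : k * (C + 1) <= e by rewrite -ler_pdivlMr// ge_min lexx orbT.
apply: le_trans ke; apply: (@le_trans _ _ (C * k * 1)); last by lra.
by rewrite expr2 mulrA ler_wpM2l// mulr_ge0.
Qed.

(** Converts a strict inequality into a real margin that can absorb error terms, also when [b] is
    infinite. *)
Lemma lt_EFin_gap (a : R) (b : \bar R) : (a%:E < b)%E ->
  exists2 e : R, 0 < e & ((a + e)%:E < b)%E.
Proof.
case: b => [b|_|]; rewrite ?lte_fin//; last by exists 1 => //; exact: ltry.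
by move=> ab; exists ((b - a) / 2); rewrite ?lte_fin ?divr_gt0 ?subr_gt0//; lra.
Qed.

End Reals.

(** * Inner product, Euclidean norm and comparison with the maximum norm *)

Section Dot.
Context {R : realType} {n : nat}.
Implicit Types u v w : 'rV[R]_n.

Lemma dotC u v : dot u v = dot v u.
Proof. by apply: eq_bigr => i _; rewrite mulrC. Qed.

Lemma dotNr u v : dot u (- v) = - dot u v.
Proof. by rewrite -scaleN1r dotZr mulN1r. Qed.

Lemma dotBr u v w : dot u (v - w) = dot u v - dot u w.
Proof. by rewrite dotDr dotNr. Qed.

Lemma dotBl u v w : dot (v - w) u = dot v u - dot w u.
Proof. by rewrite ![dot _ u]dotC dotBr. Qed.

Lemma dotZl a u v : dot (a *: u) v = a * dot u v.
Proof. by rewrite ![dot _ v]dotC dotZr. Qed.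

Lemma dot0l u : dot 0 u = 0.
Proof. by rewrite -(scale0r 0) dotZl mul0r. Qed.

Lemma coord_norm_le u i : `|u 0 i| <= `|u|.
Proof.
rewrite [leRHS]/Num.norm/= mx_normrE.
by apply: (le_bigmax _ (fun ij : 'I_1 * 'I_n => `|u ij.1 ij.2|) (0, i)).
Qed.

(** A substitute for Cauchy-Schwarz in the maximum norm, obtained by bounding each of the [n]
    products. *)
Lemma dot_norm_le u v : `|dot u v| <= n%:R * (`|u| * `|v|).
Proof.
rewrite /dot (le_trans (ler_norm_sum _ _ _))//.
have -> : n%:R * (`|u| * `|v|) = \sum_(i < n) `|u| * `|v|.
  by rewrite sumr_const card_ord mulr_natl.
by apply: ler_sum => i _; rewrite normrM ler_pM// coord_norm_le.
Qed.

Lemma dot_linear u : linear (dot u : 'rV[R]_n -> R^o).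
Proof. by move=> a v w; rewrite dotDr dotZr. Qed.

(** Makes the differentiation rules for linear maps apply to [dot u]. *)
HB.instance Definition _ u :=
  GRing.isLinear.Build R 'rV[R]_n R^o *:%R (dot u) (dot_linear u).

Lemma cvg_dot (T : Type) (F : set_system T) (g h : T -> 'rV[R]_n) u v :
  Filter F -> g @ F --> u -> h @ F --> v ->
  dot (g t) (h t) @[t --> F] --> dot u v.
Proof.
move=> FF gu hv; rewrite /dot.
have addc : continuous (fun x : R * R => x.1 + x.2).
  by move=> x; apply: (@cvgD R R^o); [exact: cvg_fst|exact: cvg_snd].
apply: (cvg_big (op := +%R) addc (F := F)) => i _.
by apply: cvgM;
  [apply: (cvg_comp g (fun u => u 0 i) gu)
  |apply: (cvg_comp h (fun u => u 0 i) hv)];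
  exact: coord_continuous.
Qed.

Lemma dot_ge0 u : 0 <= dot u u.
Proof. by apply: sumr_ge0 => i _; rewrite -expr2 sqr_ge0. Qed.

Lemma sqr_enorm u : enorm u ^+ 2 = dot u u.
Proof. by rewrite /enorm sqr_sqrtr// dot_ge0. Qed.

Lemma sqr_enormD u v :
  enorm (u + v) ^+ 2 = enorm u ^+ 2 + 2 * dot u v + enorm v ^+ 2.
Proof.
by rewrite !sqr_enorm dotDr ![dot (u + v) _]dotC !dotDr [dot v u]dotC; ring.
Qed.

Lemma enorm_ge0 u : 0 <= enorm u.
Proof. exact: sqrtr_ge0. Qed.

Lemma enorm_continuous : continuous (enorm : 'rV[R]_n -> R).
Proof.
move=> u; apply: (@continuous_comp _ _ _ (fun u => dot u u)).
  by apply: (@cvg_dot _ (nbhs u) id id) => //; exact: cvg_id.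
exact: sqrt_continuous.
Qed.

Lemma enormZ a u : enorm (a *: u) = `|a| * enorm u.
Proof.
by rewrite /enorm dotZl dotZr mulrA -expr2 sqrtrM ?sqr_ge0// sqrtr_sqr.
Qed.

(** With [sqr_enorm_le], this moves estimates between the maximum norm, used for differentials, and
    Euclidean lengths. *)
Lemma norm_le_enorm u : `|u| <= enorm u.
Proof.
rewrite [leLHS]/Num.norm/= mx_normrE; apply: bigmax_le; first exact: enorm_ge0.
move=> [i j] _ /=; rewrite ord1 -(ler_pXn2r (n := 2)) ?nnegrE ?enorm_ge0//.
rewrite sqr_enorm /dot (bigD1 j)//= real_normK ?num_real// expr2 lerDl.
by apply: sumr_ge0 => k _; rewrite -expr2 sqr_ge0.
Qed.

Lemma enorm_gt0 u : (0 < enorm u) = (u != 0).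
Proof.
have [->|u0] := eqVneq u 0; first by rewrite /enorm dot0l sqrtr0 ltxx.
by rewrite (lt_le_trans _ (norm_le_enorm u))// normr_gt0.
Qed.

Lemma sqr_enorm_le u : enorm u ^+ 2 <= n%:R * `|u| ^+ 2.
Proof. by rewrite sqr_enorm expr2 (le_trans (ler_norm _))// dot_norm_le. Qed.

Lemma compact_enorm_sphere : compact [set u : 'rV[R]_n | enorm u = 1].
Proof.
apply: bounded_closed_compact.
  exists 1; split; first exact: num_real.
  by move=> M M1 u /= u1; rewrite (le_trans (norm_le_enorm u))// u1 ltW.
apply: (@closed_comp _ _ enorm [set 1]) => [u _|]; last exact: closed_eq.
exact: enorm_continuous.
Qed.

End Dot.

(** * Local expansions by the differential *)

Section Differential.
Context {R : realType}.

Lemma differentiable_near (V W : normedModType R) (h : V -> W) x :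
  differentiable h x -> forall e : R, 0 < e ->
  \forall d \near (0 : V), `|h (x + d) - h x - 'd h x d| <= e * `|d|.
Proof.
move=> dh e e0.
have /eqaddoP/(_ e e0) := diff_locally dh.
by apply: filterS => d; rewrite [x + d]addrC -addrA -opprD.
Qed.

(** Differentials are local. This serves the gradient of the Lagrangian, whose formula is available
    only near the base point. *)
Lemma near_eq_is_diff (V W : normedModType R) (g h : V -> W) x :
  {near x, g =1 h} -> differentiable g x -> is_diff x h ('d g x).
Proof.
move=> gh dg.
have hE : h \o shift x = cst (h x) + 'd g x +o_ 0 id.
  apply/eqaddoP => e e0.
  have gh0 : \forall d \near (0 : V), g (x + d) = h (x + d).
    by move/nbhs0P : gh; apply: filterS => d /=; rewrite addrC.
  apply: filterS2 gh0 (differentiable_near dg e0) => d ghd.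
  by rewrite ghd (nbhs_singleton gh) [x + d]addrC -addrA -opprD.
have gc := diff_continuous dg.
have hd : 'd h x = 'd g x :> (V -> W) by exact: diff_unique.
by apply: DiffDef => //; apply/diff_locallyP; rewrite hd.
Qed.

End Differential.

(** * Gradients, Hessians and a second-order Taylor expansion *)

Section Gradient.
Context {R : realType} {n : nat}.
Implicit Types (h : 'rV[R]_n -> R) (x d : 'rV[R]_n).

Lemma diff_gradient h x d :
  'd (h : 'rV[R]_n -> R^o) x d = dot (gradient h x) d.
Proof.
rewrite {1}[d]row_sum_delta linear_sum /dot; apply: eq_bigr => i _.
by rewrite linearZ /gradient mxE mulrC.
Qed.

Lemma diff_gradient_hessian h x d :
  'd (gradient h) x d = d *m hessian h x.
Proof. by rewrite /hessian /jacobian mul_rV_lin1. Qed.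

Lemma is_derive_segment h x d (s : R) :
  differentiable (h : 'rV[R]_n -> R^o) (x + s *: d) ->
  is_derive s 1 (fun s => h (x + s *: d) : R^o)
    (dot (gradient h (x + s *: d)) d).
Proof.
move=> dh.
pose k (s : R) := x + s *: d.
have dk : is_diff s k (0 + ( *:%R ^~ d)) by apply: is_diffD.
have dhk : differentiable ((h : 'rV[R]_n -> R^o) \o k) s.
  exact: differentiable_comp.
apply: DeriveDef; first exact: diff_derivable.
rewrite deriveE// diff_comp//= diff_val/= -diff_gradient.
by congr ('d _ _ _); rewrite /GRing.add_fun add0r scale1r.
Qed.

(** When [a] and [b] are the Taylor coefficients of orders one and two along [d], the increment of
    this function over [[0, 1]] is the Taylor remainder. *)
Lemma is_derive_segment_quadratic h x d (a b s : R) :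
  differentiable (h : 'rV[R]_n -> R^o) (x + s *: d) ->
  is_derive s 1
    ((fun s => h (x + s *: d) : R)
     - a \*: (id : R -> R) - b \*: (id : R -> R) ^+ 2)
    (dot (gradient h (x + s *: d)) d - a - b * (2 * s)).
Proof.
move=> ds; have dk := is_derive_segment ds.
have da := is_deriveZ a (is_derive_id s (1 : R)).
have db := is_deriveZ b (is_deriveX 2 (is_derive_id s (1 : R))).
have dg := is_deriveB (is_deriveB dk da) db.
apply: (is_derive_eq dg); rewrite expr1.
by rewrite /GRing.scale/= !mulr1.
Qed.

(** The gradient is differentiable only at [x], so the mean value theorem is applied once, along the
    segment, and the first-order expansion of the gradient bounds the derivative it produces. *)
Lemma second_order_taylor h x : twice_differentiable_fun h x ->
  forall e : R, 0 < e -> \forall d \near (0 : 'rV[R]_n),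
  `|h (x + d) - h x - dot (gradient h x) d - 2^-1 * dot (d *m hessian h x) d|
    <= e * `|d| ^+ 2.
Proof.
move=> [dh dg] e e0.
(* Offsets the factor [n] of [dot_norm_le]; the successor also covers [n = 0]. *)
have en0 : 0 < e / n.+1%:R by rewrite divr_gt0.
have hg := differentiable_near dg en0.
have hd : \forall d \near (0 : 'rV[R]_n),
    differentiable (h : 'rV[R]_n -> R^o) (x + d).
  by move/nbhs0P : dh; apply: filterS => d; rewrite addrC.
have [r /= r0 Hr] := nbhs_norm0P.1 (filterI hg hd).
apply/nbhs_norm0P; exists r => // d /= dr.
have Br s : 0 <= s <= 1 ->
    `|gradient h (x + s *: d) - gradient h x - 'd (gradient h) x (s *: d)|
      <= e / n.+1%:R * `|s *: d|
    /\ differentiable (h : 'rV[R]_n -> R^o) (x + s *: d).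
  move=> /andP[s0 s1]; apply: Hr; rewrite /= normrZ ger0_norm//.
  by rewrite (le_lt_trans _ dr)// ler_piMl.
have dgs (s : R) (s01 : 0 <= s <= 1) :=
  is_derive_segment_quadratic (dot (gradient h x) d)
    (2^-1 * dot (d *m hessian h x) d) (Br s s01).2.
have [|c c01 ceq] := @MVT R _ _ 0 1 ltr01
  (fun s s01 => dgs s (subset_itv_oo_cc s01)).
  apply: derivable_within_continuous => s s01.
  exact: (ex_derive (is_derive := dgs s s01)).
have {}c01 : 0 <= c <= 1 by exact: subset_itv_oo_cc c01.
(* Conversion evaluates the pointwise operations on functions: [id ^+ 2] at [s] becomes [s * s]. *)
have {ceq} : h (x + 1 *: d) - dot (gradient h x) d * 1 -
      2^-1 * dot (d *m hessian h x) d * (1 * 1) -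
    (h (x + 0 *: d) - dot (gradient h x) d * 0 -
      2^-1 * dot (d *m hessian h x) d * (0 * 0)) =
    (dot (gradient h (x + c *: d)) d - dot (gradient h x) d -
      2^-1 * dot (d *m hessian h x) d * (2 * c)) * (1 - 0) by exact: ceq.
rewrite scale1r scale0r addr0 subr0 !mulr1 !mulr0 !subr0 => ceq.
(* The factor [2 * c] cancels the half, so the remainder is the first-order error of the gradient at
   [c *: d], paired with [d]. *)
have -> : h (x + d) - h x - dot (gradient h x) d -
      2^-1 * dot (d *m hessian h x) d =
    dot (gradient h (x + c *: d) - gradient h x - 'd (gradient h) x (c *: d)) d.
  rewrite diff_gradient_hessian -scalemxAl !dotBl dotZl.
  have -> : c * dot (d *m hessian h x) d =
            2^-1 * dot (d *m hessian h x) d * (2 * c).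
    by rewrite mulrACA mulVf// mul1r mulrC.
  by rewrite -ceq [RHS]addrAC; congr (_ - _); rewrite [RHS]addrAC.
have [gd _] := Br c c01; move/andP: c01 => [c0 c1].
have cd : `|c *: d| <= `|d| by rewrite normrZ ger0_norm// ler_piMl.
apply: (le_trans (dot_norm_le _ _)).
apply: (@le_trans _ _ (n%:R * (e / n.+1%:R * `|d| * `|d|))).
  by rewrite ler_wpM2l// ler_wpM2r// (le_trans gd)// ler_wpM2l// ltW.
rewrite -mulrA -expr2 mulrA ler_wpM2r ?exprn_ge0//.
by rewrite mulrCA ger_pMr// ler_pdivrMr ?ltr0n// mul1r ler_nat.
Qed.

End Gradient.

(** * Twice differentiability of the Lagrangian *)

Section Lagrangian.
Context {R : realType} {n m : nat}.
Implicit Types (phi : 'rV[R]_n -> R) (f : 'rV[R]_n -> 'rV[R]_m).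

Lemma differentiable_lagrangian phi f (lambda : 'rV[R]_m) x :
  differentiable (phi : 'rV[R]_n -> R^o) x -> differentiable f x ->
  differentiable ((fun z => lagrangian phi f z lambda) : 'rV[R]_n -> R^o) x.
Proof.
move=> dphi df; apply: (@differentiableD _ _ R^o) => //.
apply: (@differentiable_comp _ _ _ R^o f (dot lambda)) => //.
exact/linear_differentiable/dot_continuous.
Qed.

Lemma diff_lagrangian phi f (lambda : 'rV[R]_m) x :
  differentiable (phi : 'rV[R]_n -> R^o) x -> differentiable f x ->
  'd ((fun z => lagrangian phi f z lambda) : 'rV[R]_n -> R^o) x =
  'd (phi : 'rV[R]_n -> R^o) x \+ (dot lambda \o 'd f x) :> ('rV[R]_n -> R^o).
Proof.
move=> dphi df.
have dl := @linear_differentiable _ _ R^o (dot lambda) (f x)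
  (@dot_continuous _ _ lambda).
have dlE : 'd (dot lambda : 'rV[R]_m -> R^o) (f x) = dot lambda
    :> ('rV[R]_m -> R^o).
  exact: (@diff_lin _ _ R^o (dot lambda) _ (@dot_continuous _ _ lambda)).
have dlf := @differentiable_comp _ _ _ R^o f (dot lambda) x df dl.
apply: (etrans (diffD dphi dlf)); congr (_ \+ _).
by apply: (etrans (diff_comp df dl)); rewrite dlE.
Qed.

(** The double sum is [lambda *m ('J f x)^T], split into scalar entries of the Jacobian times
    constant vectors so that it can be differentiated term by term. *)
Lemma gradient_lagrangian phi f (lambda : 'rV[R]_m) x :
  differentiable (phi : 'rV[R]_n -> R^o) x -> differentiable f x ->
  gradient (fun z => lagrangian phi f z lambda) x =
  gradient phi x + \sum_(i < n) \sum_(j < m)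
    'J f x i j *: (lambda 0 j *: delta_mx 0 i).
Proof.
move=> dphi df; apply/rowP => i; rewrite !mxE.
have := congr1 (fun k => k (delta_mx 0 i)) (diff_lagrangian lambda dphi df).
move=> -> /=.
congr (_ + _); rewrite summxE (bigD1 i)//= [X in _ + X]big1 ?addr0 => [|k ki].
  rewrite summxE /dot; apply: eq_bigr => j _.
  by rewrite !mxE !eqxx mulr1 mulrC.
rewrite summxE big1// => j _.
by rewrite !mxE [i == k]eq_sym (negbTE ki) andbF !mulr0.
Qed.

Lemma twice_differentiable_lagrangian phi f (lambda : 'rV[R]_m) x :
  twice_differentiable_fun phi x -> twice_differentiable_map f x ->
  twice_differentiable_fun (fun z => lagrangian phi f z lambda) x.
Proof.
move=> [dphi ddphi] [df ddf]; split.
  apply: filterS2 dphi df => z; exact: differentiable_lagrangian.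
have dG : differentiable (gradient phi + \sum_(i < n) \sum_(j < m)
    (fun z => 'J f z i j *: (lambda 0 j *: delta_mx 0 i : 'rV[R]_n))) x.
  apply: differentiableD => //; apply: differentiable_sum => i.
  apply: differentiable_sum => j; apply: differentiableZl.
  apply: (@differentiable_comp _ _ _ _ (fun z => 'J f z)
    (fun N : 'M[R]_(n, m) => N i j)) => //.
  exact: differentiable_coord.
have gG : {near x, gradient phi + \sum_(i < n) \sum_(j < m)
    (fun z => 'J f z i j *: (lambda 0 j *: delta_mx 0 i : 'rV[R]_n)) =1
    gradient (fun z => lagrangian phi f z lambda)}.
  apply: filterS2 dphi df => z dphiz dfz; rewrite gradient_lagrangian//.
  rewrite fctE; congr (_ + _); rewrite fct_sumE; apply: eq_bigr => i _.
  by rewrite fct_sumE.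
by have [] := near_eq_is_diff gG dG.
Qed.

End Lagrangian.

(** * Euclidean distance to a set *)

Section Distance.
Context {R : realType} {m : nat}.
Implicit Types (S : set 'rV[R]_m) (x z : 'rV[R]_m).

Lemma dist_to_lbound x S : lbound [set enorm (x - z) | z in S] 0.
Proof. by move=> _ [z _ <-]; exact: enorm_ge0. Qed.

Lemma dist_to_ge0 x S : S !=set0 -> 0 <= dist_to x S.
Proof.
move=> [z Sz]; apply: lb_le_inf; last exact: dist_to_lbound.
by exists (enorm (x - z)), z.
Qed.

Lemma dist_to_le x S z : S z -> dist_to x S <= enorm (x - z).
Proof.
move=> Sz; apply: ge_inf; last by exists z.
by exists 0; exact: dist_to_lbound.
Qed.

(** Square roots reduce this to the greatest lower bound property. The case [c < 0] does occur, as
    [c] comes from rearranging the augmented Lagrangian. *)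
Lemma le_sqr_dist_to x S (c : R) : S !=set0 ->
  (forall z, S z -> c <= enorm (x - z) ^+ 2) -> c <= dist_to x S ^+ 2.
Proof.
move=> S0 cS; have [c0|c0] := ltP c 0.
  by rewrite (le_trans (ltW c0))// sqr_ge0.
rewrite -[leLHS]sqr_sqrtr// ler_pXn2r ?nnegrE ?dist_to_ge0 ?sqrtr_ge0//.
apply: lb_le_inf; first by case: S0 => z0 Sz0; exists (enorm (x - z0)), z0.
move=> _ [z Sz <-]; rewrite -[leRHS]ger0_norm ?enorm_ge0// -sqrtr_sqr.
by rewrite ler_wsqrtr// cS.
Qed.

End Distance.

(** * The augmented Lagrangian as an infimum over [Theta] *)

Section AugmentedLagrangian.
Context {R : realType} {n m : nat}.
Context (phi : 'rV[R]_n -> R) (f : 'rV[R]_n -> 'rV[R]_m).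
Context (Theta : set 'rV[R]_m) (lambda : 'rV[R]_m).
Implicit Types (x : 'rV[R]_n) (s : 'rV[R]_m) (rho : R).

(** Affine in [rho] with nonnegative slope, which is what makes the infimum over [s] monotone in
    [rho]. *)
Let pen x rho s :=
  lagrangian phi f x lambda - dot lambda s + rho / 2 * enorm (f x - s) ^+ 2.

(** Completing the square: adding [rho^-1 *: lambda] to [f x - s] produces the cross term
    [dot lambda (f x - s)] after scaling by [rho / 2]. *)
Lemma penE x rho s : 0 < rho -> pen x rho s =
  phi x + rho / 2 * (enorm (f x + rho^-1 *: lambda - s) ^+ 2
                     - enorm (rho^-1 *: lambda) ^+ 2).
Proof.
move=> rho0; rewrite addrAC sqr_enormD addrK dotZr [dot (f x - s) _]dotC dotBr.
by rewrite /pen /lagrangian; field; rewrite gt_eqF.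
Qed.

(** With [le_aug_lagrangian], this identifies the augmented Lagrangian as the infimum of [pen] over
    [Theta]. *)
Lemma aug_lagrangian_le x rho s : 0 < rho -> Theta s ->
  aug_lagrangian phi f Theta x lambda rho <= pen x rho s.
Proof.
move=> rho0 Ts; rewrite penE// lerD2l; apply: ler_wpM2l.
  by rewrite divr_ge0// ltW.
rewrite lerD2r ler_pXn2r ?nnegrE ?enorm_ge0 ?dist_to_le ?dist_to_ge0//.
by exists s.
Qed.

Lemma le_aug_lagrangian x rho c : 0 < rho -> Theta !=set0 ->
  (forall s, Theta s -> c <= pen x rho s) ->
  c <= aug_lagrangian phi f Theta x lambda rho.
Proof.
move=> rho0 T0 cpen.
rewrite /aug_lagrangian -lerBlDl mulrC -ler_pdivrMr ?divr_gt0//.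
rewrite lerBrDr; apply: le_sqr_dist_to => // s Ts.
by rewrite -lerBrDr ler_pdivrMr ?divr_gt0// mulrC lerBlDl -penE// cpen.
Qed.

(** Extends quadratic growth from one parameter to all larger ones. *)
Lemma aug_lagrangian_mono x rho rho' : Theta !=set0 -> 0 < rho -> rho <= rho' ->
  aug_lagrangian phi f Theta x lambda rho
    <= aug_lagrangian phi f Theta x lambda rho'.
Proof.
move=> T0 rho0 rho_le; apply: le_aug_lagrangian => // [|s Ts].
  exact: lt_le_trans rho_le.
apply: (le_trans (aug_lagrangian_le x rho0 Ts)).
by rewrite lerD2l ler_wpM2r ?sqr_ge0// ler_wpM2r.
Qed.

(** The choice [s = f x] gives the value [phi x], and the normal cone inequality makes it the
    least. *)
Lemma aug_lagrangian_multiplier x rho :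
  0 < rho -> normal_cone Theta (f x) lambda ->
  aug_lagrangian phi f Theta x lambda rho = phi x.
Proof.
move=> rho0 [Tx Nx]; apply/eqP; rewrite eq_le; apply/andP; split.
  rewrite (le_trans (aug_lagrangian_le x rho0 Tx))//.
  rewrite /pen /lagrangian addrK subrr.
  by rewrite sqr_enorm dot0l mulr0 addr0.
apply: le_aug_lagrangian => //; first by exists (f x).
move=> s Ts; have := Nx s Ts; rewrite dotBr => ls.
have : 0 <= rho / 2 * enorm (f x - s) ^+ 2.
  by rewrite mulr_ge0 ?divr_ge0 ?sqr_ge0// ltW.
rewrite /pen /lagrangian; lra.
Qed.

End AugmentedLagrangian.

(** * Eventual bounds for second subderivatives *)

Section SecondSubderivative.
Context {R : realType} {m : nat}.
Implicit Types (psi : 'rV[R]_m -> \bar R) (x v w : 'rV[R]_m).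

(** The lower limit is a supremum of infima over neighbourhoods, so a strict lower bound already
    holds on one of them. *)
Lemma second_subderivative_gt psi x v w a :
  (a < second_subderivative psi x v w)%E ->
  \forall t \near 0^'+ & u \near w, (a < second_quotient psi x v t u)%E.
Proof.
rewrite /second_subderivative limf_einfE => /ereal_sup_gt[_ [V FV <-]] aV.
apply: filterS FV => p Vp; apply: (lt_le_trans aV).
by apply: ereal_inf_lbound; exists p.
Qed.

Lemma le_second_subderivative psi x v w a :
  (\forall t \near 0^'+ & u \near w, (a <= second_quotient psi x v t u)%E) ->
  (a <= second_subderivative psi x v w)%E.
Proof.
move=> aq; rewrite /second_subderivative limf_einfE.
apply: le_trans (ereal_sup_ubound _); last by eexists; [exact: aq|reflexivity].
by apply: le_ereal_inf_tmp => _ [p ap <-].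
Qed.

End SecondSubderivative.

(** * Expansions along [t *: w'] as [t] decreases to 0 and [w'] tends to [w] *)

Section Expansions.
Context {R : realType} {n : nat}.
Implicit Types (x w : 'rV[R]_n).

(** Turns bounds in a small increment into bounds along directions, since [t *: w'] tends to 0. *)
Lemma near_right_scale w (P : set 'rV[R]_n) :
  (\forall d \near (0 : 'rV[R]_n), P d) ->
  \forall t \near (0 : R)^'+ & w' \near w, P (t *: w').
Proof.
move=> P0.
have : p.1 *: p.2 @[p --> filter_prod (0 : R)^'+ (nbhs w)] --> (0 : 'rV[R]_n).
  rewrite -[X in _ --> X](scale0r w); apply: cvgZ; last exact: cvg_snd.
  apply: (cvg_trans cvg_fst); exact: cvg_at_right_filter.
by apply.
Qed.

Lemma near_right_fst w (P : set R) : (\forall t \near (0 : R)^'+, P t) ->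
  \forall t \near (0 : R)^'+ & w' \near w, P t.
Proof. by move=> P0; exact: (@cvg_fst _ _ _ _ (nbhs_filter w)). Qed.

Lemma near_right_snd w (P : set 'rV[R]_n) : (\forall w' \near w, P w') ->
  \forall t \near (0 : R)^'+ & w' \near w, P w'.
Proof. by move=> Pw; exact: cvg_snd. Qed.

Lemma near_right_diag w (P : R -> 'rV[R]_n -> Prop) :
  (\forall t \near (0 : R)^'+ & w' \near w, P t w') ->
  \forall t \near (0 : R)^'+, P t w.
Proof.
move=> [[A B] /= [FA FB] AB]; apply: filterS FA => t At.
by apply: (AB (t, w)); split => //=; exact: nbhs_singleton.
Qed.

(** The shape required by the compactness argument: directions are covered, and the pair of [t] and
    the penalty parameter is the filter along which the estimate becomes uniform. *)
Lemma near_right_pinfty w (P : R -> 'rV[R]_n -> Prop) :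
  (\forall t \near (0 : R)^'+ & w' \near w, P t w') ->
  \forall w' \near w & i \near filter_prod (0 : R)^'+ (pinfty_nbhs R), P i.1 w'.
Proof.
move=> [[A B] /= [FA FB] AB]; exists (B, fst @^-1` A).
  by split => //=; exact: cvg_fst.
by move=> [w' [t M]] /= [Bw At]; apply: (AB (t, w')).
Qed.

Lemma near_pinfty_snd w (P : set R) : (\forall M \near +oo, P M) ->
  \forall w' \near w & i \near filter_prod (0 : R)^'+ (pinfty_nbhs R), P i.2.
Proof.
move=> PM; exists (setT, snd @^-1` P); last by move=> [w' [t M]] /= [].
by split => /=; [exact: filterT|exact: cvg_snd].
Qed.

Lemma near_norm_le w : \forall w' \near w, `|w'| <= `|w| + 1.
Proof.
near=> w'; rewrite -[w'](subrK w) addrC (le_trans (ler_normD _ _))// lerD2l.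
by rewrite distrC ltW//; near: w'; exact: nbhsx_ballx.
Unshelve. all: by end_near. Qed.

(** Half of [e] pays for the remainder at [t *: w'], the other half for replacing [w'] by [w] inside
    the differential. *)
Lemma near_right_first_order m (f : 'rV[R]_n -> 'rV[R]_m) x w (e : R) :
  differentiable f x -> 0 < e ->
  \forall t \near (0 : R)^'+ & w' \near w,
    `|f (x + t *: w') - f x - t *: 'd f x w| <= e * t.
Proof.
move=> df e0; have w0 : 0 < 2 * (`|w| + 1) by rewrite mulr_gt0// ltr_wpDl.
have e20 : 0 < e / 2 by rewrite divr_gt0.
have e'0 : 0 < e / (2 * (`|w| + 1)) by rewrite divr_gt0.
have Hf := near_right_scale w (differentiable_near df e'0).
have Hd : \forall w' \near w, `|'d f x w - 'd f x w'| <= e / 2.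
  have /(_ w) dfc := diff_continuous df.
  by move/cvgrPdist_le : dfc; exact.
have {}Hd := near_right_snd Hd.
have Ht : \forall t \near (0 : R)^'+ & w' \near w, 0 < t.
  by apply: near_right_fst; exact: nbhs_right_gt.
have Hw := near_right_snd (near_norm_le w).
near=> p.
have t0 : 0 < p.1 by near: p; exact: Ht.
have ww : `|p.2| <= `|w| + 1 by near: p; exact: Hw.
have dw : `|'d f x w - 'd f x p.2| <= e / 2 by near: p; exact: Hd.
have fw : `|f (x + p.1 *: p.2) - f x - 'd f x (p.1 *: p.2)|
    <= e / (2 * (`|w| + 1)) * `|p.1 *: p.2|.
  by near: p; exact: Hf.
have -> : f (x + p.1 *: p.2) - f x - p.1 *: 'd f x w =
   (f (x + p.1 *: p.2) - f x - 'd f x (p.1 *: p.2)) -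
   p.1 *: ('d f x w - 'd f x p.2).
  have -> : 'd f x (p.1 *: p.2) = p.1 *: 'd f x p.2 by exact: linearZ.
  by rewrite scalerBr opprB [RHS]addrA subrK.
rewrite (le_trans (ler_normB _ _))// [X in X * p.1]splitr mulrDl lerD//.
  have -> : e / 2 * p.1 = e / (2 * (`|w| + 1)) * (p.1 * (`|w| + 1)).
    by field; rewrite gt_eqF// ltr_wpDl.
  rewrite (le_trans fw)// normrZ gtr0_norm// ler_wpM2l ?(ltW e'0)//.
  by rewrite ler_wpM2l// ltW.
by rewrite normrZ gtr0_norm// mulrC ler_wpM2r// ltW.
Unshelve. all: by end_near. Qed.

(** The vanishing gradient removes the linear term, in which replacing [w'] by [w] would cost more
    than order [t ^+ 2]. *)
Lemma near_right_second_order (h : 'rV[R]_n -> R) x w (e : R) :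
  twice_differentiable_fun h x -> gradient h x = 0 -> 0 < e ->
  \forall t \near (0 : R)^'+ & w' \near w,
    `|h (x + t *: w') - h x - 2^-1 * t ^+ 2 * dot (w *m hessian h x) w|
      <= e * t ^+ 2.
Proof.
move=> h2 h0 e0.
have w0 : 0 < 2 * (`|w| + 1) ^+ 2 by rewrite mulr_gt0// exprn_gt0// ltr_wpDl.
have e'0 : 0 < e / (2 * (`|w| + 1) ^+ 2) by rewrite divr_gt0.
have Hf := near_right_scale w (second_order_taylor h2 e'0).
have /(_ w) dc := diff_continuous h2.2.
have Hq : dot ('d (gradient h) x w') w' @[w' --> w]
    --> dot ('d (gradient h) x w) w.
  exact: (@cvg_dot _ _ _ (nbhs w) ('d (gradient h) x) id _ _ (nbhs_filter w)
    dc cvg_id).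
have /cvgrPdist_le/(_ _ e0) {}Hq := Hq.
have {}Hq := near_right_snd Hq.
have Ht : \forall t \near (0 : R)^'+ & w' \near w, 0 < t.
  by apply: near_right_fst; exact: nbhs_right_gt.
have Hw := near_right_snd (near_norm_le w).
near=> p.
have t0 : 0 < p.1 by near: p; exact: Ht.
have ww : `|p.2| <= `|w| + 1 by near: p; exact: Hw.
have dw : `|dot (w *m hessian h x) w - dot (p.2 *m hessian h x) p.2| <= e.
  by rewrite -!diff_gradient_hessian; near: p; exact: Hq.
have fw : `|h (x + p.1 *: p.2) - h x - dot (gradient h x) (p.1 *: p.2) -
     2^-1 * dot ((p.1 *: p.2) *m hessian h x) (p.1 *: p.2)|
     <= e / (2 * (`|w| + 1) ^+ 2) * `|p.1 *: p.2| ^+ 2.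
  by near: p; exact: Hf.
rewrite h0 dot0l subr0 -scalemxAl dotZl dotZr in fw.
set q := dot (w *m _) w in dw *; set q' := dot (p.2 *m _) p.2 in dw fw *.
have -> : h (x + p.1 *: p.2) - h x - 2^-1 * p.1 ^+ 2 * q =
   (h (x + p.1 *: p.2) - h x - 2^-1 * (p.1 * (p.1 * q'))) -
   2^-1 * p.1 ^+ 2 * (q - q').
  by ring.
rewrite (le_trans (ler_normB _ _))// [X in X * _ ^+ 2]splitr mulrDl lerD//.
  have -> : e / 2 * p.1 ^+ 2 =
            e / (2 * (`|w| + 1) ^+ 2) * (p.1 * (`|w| + 1)) ^+ 2.
    by field; rewrite gt_eqF// ltr_wpDl.
  rewrite (le_trans fw)// normrZ gtr0_norm// ler_wpM2l ?(ltW e'0)//.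
  by rewrite ler_pXn2r ?nnegrE ?mulr_ge0 ?addr_ge0 ?ler_wpM2l ?(ltW t0)//.
have q0 : 0 <= 2^-1 * p.1 ^+ 2 by rewrite mulr_ge0 ?sqr_ge0.
have -> : e / 2 * p.1 ^+ 2 = 2^-1 * p.1 ^+ 2 * e by ring.
by rewrite normrM (ger0_norm q0) ler_wpM2l.
Unshelve. all: by end_near. Qed.

End Expansions.

(** * Upper bound, quadratic growth and positivity for the augmented Lagrangian *)

Section SecondOrderConditions.
Context {R : realType} {n m : nat}.
Context (phi : 'rV[R]_n -> R) (f : 'rV[R]_n -> 'rV[R]_m).
Context (Theta : set 'rV[R]_m) (x : 'rV[R]_n) (lambda : 'rV[R]_m).
Context (phi_diff : twice_differentiable_fun phi x)
        (f_diff : twice_differentiable_map f x).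
Context (stationary : gradient (fun z => lagrangian phi f z lambda) x = 0)
        (multiplier : normal_cone Theta (f x) lambda).

Let L z := lagrangian phi f z lambda.
Let Q w := dot (w *m hessian L x) w.
Let d2Theta := second_subderivative (indic_fun Theta) (f x) lambda.
Let aug rho z := aug_lagrangian phi f Theta z lambda rho.

Let L_diff : twice_differentiable_fun L x.
Proof. exact: twice_differentiable_lagrangian. Qed.

Let fx_diff : differentiable f x.
Proof. by have := nbhs_singleton f_diff.1. Qed.

(** The quotient of [aug] is taken in the fixed direction [w], with [f x + t *: v] as competitor in
    the infimum; only [v] varies, near ['d f x w]. *)
Lemma lt_second_subderivative_aug w rho (c : R) : 0 < rho ->
  (c%:E < second_subderivative (fun z => (aug rho z)%:E) x 0 w)%E ->
  (c%:E <= (Q w)%:E + d2Theta ('d f x w))%E.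
Proof.
move=> rho0 caug; apply/lee_subgt0Pr => e e0.
rewrite -leeBlDl// -[leLHS]/((c - e - Q w)%:E); apply: le_second_subderivative.
(* Below, [f (x + t *: w)] is within [2 * k * t] of the competitor in maximum norm; [m] converts the
   square to Euclidean length, so the penalty is at most [e / 8 * t ^+ 2]. *)
have [k k0 ke] : exists2 k, 0 < k & rho / 2 * (m%:R * 4) * k ^+ 2 <= e / 8.
  by apply: exists_small_sqr; rewrite ?divr_gt0// !mulr_ge0// ltW// invr_gt0.
have e80 : 0 < e / 8 by rewrite divr_gt0.
have H1 := near_right_fst ('d f x w)
  (near_right_diag (second_subderivative_gt caug)).
have H2 := near_right_fst ('d f x w)
  (near_right_diag (near_right_second_order w L_diff stationary e80)).
have H3 := near_right_fst ('d f x w)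
  (near_right_diag (near_right_first_order w fx_diff k0)).
have H4 : \forall v \near 'd f x w, `|'d f x w - v| < k.
  by have /cvgrPdist_lt := @cvg_id _ (nbhs ('d f x w)); exact.
have {}H4 := near_right_snd H4.
have H5 := near_right_fst ('d f x w) (nbhs_right_gt (0 : R)).
near=> p.
have q1 : (c%:E < second_quotient (fun z => (aug rho z)%:E) x 0 p.1 w)%E.
  by near: p; exact: H1.
have q2 : `|L (x + p.1 *: w) - L x - 2^-1 * p.1 ^+ 2 * Q w| <= e / 8 * p.1 ^+ 2.
  by near: p; exact: H2.
have q3 : `|f (x + p.1 *: w) - f x - p.1 *: 'd f x w| <= k * p.1.
  by near: p; exact: H3.
have q4 : `|'d f x w - p.2| < k by near: p; exact: H4.
have t0 : 0 < p.1 by near: p; exact: H5.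
move: q1 q2 q3 q4 t0; move: p.1 p.2 => t v q1 q2 q3 q4 t0.
have [Tv|nTv] := pselect (Theta (f x + t *: v)); last first.
  by rewrite second_quotient_indic_pinfty ?leey//; case: multiplier.
have t20 : 0 < 2^-1 * t ^+ 2 by rewrite mulr_gt0 ?invr_gt0// exprn_gt0.
rewrite second_quotient_indic//; last by case: multiplier.
rewrite lee_fin ler_pdivlMr//.
move: q1; rewrite /second_quotient dot0l mulr0 sube0 -EFinB -EFinM lte_fin.
rewrite {2}/aug aug_lagrangian_multiplier// ltr_pdivlMr// => q1.
have augle := aug_lagrangian_le phi f lambda (x + t *: w) rho0 Tv.
have dv : `|f (x + t *: w) - (f x + t *: v)| <= 2 * k * t.
  have -> : f (x + t *: w) - (f x + t *: v) =
      (f (x + t *: w) - f x - t *: 'd f x w) + t *: ('d f x w - v).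
    by rewrite scalerBr addrA subrK opprD addrA.
  rewrite (le_trans (ler_normD _ _))// -mulrA mulr_natl mulr2n lerD//.
  by rewrite normrZ gtr0_norm// mulrC ler_wpM2r ?ltW.
have ev : rho / 2 * enorm (f (x + t *: w) - (f x + t *: v)) ^+ 2
    <= e / 8 * t ^+ 2.
  apply: (@le_trans _ _ (rho / 2 * (m%:R * (2 * k * t) ^+ 2))).
    rewrite ler_wpM2l ?divr_ge0 ?(ltW rho0)// (le_trans (sqr_enorm_le _))//.
    by rewrite ler_wpM2l// ler_pXn2r ?nnegrE// !mulr_ge0// ltW.
  have -> : rho / 2 * (m%:R * (2 * k * t) ^+ 2) =
            rho / 2 * (m%:R * 4) * k ^+ 2 * t ^+ 2 by field.
  by rewrite ler_wpM2r ?sqr_ge0.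
move: augle; rewrite dotDr dotZr -/(L _) -/(aug rho (x + t *: w)).
have LE : L x = phi x + dot lambda (f x) by [].
move: q2; rewrite ler_norml => /andP[_].
have et0 : 0 <= e * t ^+ 2 by rewrite mulr_ge0 ?sqr_ge0// ltW.
by lra.
Unshelve. all: by end_near. Qed.

(** With the rate [i.2^-1], a single limit in the penalty parameter both strengthens the penalty and
    brings the growth below the available margin. *)
Lemma near_aug_growth w : (0 < (Q w)%:E + d2Theta ('d f x w))%E ->
  \forall w' \near w & i \near filter_prod (0 : R)^'+ (pinfty_nbhs R),
    phi x + i.2^-1 * i.1 ^+ 2 <= aug i.2 (x + i.1 *: w').
Proof.
(* Indicator quotients exceed [- Q w + e] for [t] in [A] and [v] in [B]. *)
rewrite addeC -lteBlDr// sub0e -EFinN => /lt_EFin_gap[e e0].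
move=> /second_subderivative_gt[[A B] /= [FA FB] AB].
(* The margin contributes [e / 2 * t ^+ 2]: one [eta * t ^+ 2] for the Taylor error, one for the
   growth. *)
pose eta := e / 4; have eta0 : 0 < eta by rewrite divr_gt0.
have /nbhs_ballP[r /= r0] := FB; rewrite -ball_normE => Br.
have r20 : 0 < r / 2 by rewrite divr_gt0.
have H1 := near_right_pinfty (near_right_second_order w L_diff stationary eta0).
have H2 := near_right_pinfty (near_right_first_order w fx_diff r20).
have H3 := near_right_pinfty (near_right_fst w (nbhs_right_gt (0 : R))).
have H4 := near_right_pinfty (near_right_fst w FA).
have H5 := near_pinfty_snd w (nbhs_pinfty_gt (num_real eta^-1)).
(* Beyond this threshold, a penalty at distance [t * (r / 2)] compensates a possibly negative [Q w]
   and leaves the same margin. *)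
have H6 := near_pinfty_snd w
  (nbhs_pinfty_gt (num_real ((4 * eta - Q w) / (r / 2) ^+ 2))).
near=> p.
have q1 : `|L (x + p.2.1 *: p.1) - L x - 2^-1 * p.2.1 ^+ 2 * Q w|
    <= eta * p.2.1 ^+ 2.
  by near: p; exact: H1.
have q2 : `|f (x + p.2.1 *: p.1) - f x - p.2.1 *: 'd f x w| <= r / 2 * p.2.1.
  by near: p; exact: H2.
have t0 : 0 < p.2.1 by near: p; exact: H3.
have At : A p.2.1 by near: p; exact: H4.
have M1 : eta^-1 < p.2.2 by near: p; exact: H5.
have M2 : (4 * eta - Q w) / (r / 2) ^+ 2 < p.2.2 by near: p; exact: H6.
move: q1 q2 t0 At M1 M2; move: p.1 p.2.1 p.2.2 => w' t M q1 q2 t0 At M1 M2.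
have M0 : 0 < M by apply: lt_trans M1; rewrite invr_gt0.
have [Tx Nx] := multiplier.
apply: le_aug_lagrangian => // [|s Ts]; first by exists (f x).
have ls := Nx s Ts; rewrite dotBr in ls.
have Mt : M^-1 * t ^+ 2 <= eta * t ^+ 2.
  by rewrite ler_wpM2r ?sqr_ge0// -[leRHS]invrK lef_pV2 ?posrE ?invr_gt0// ltW.
have t20 : 0 < 2^-1 * t ^+ 2 by rewrite mulr_gt0 ?invr_gt0// exprn_gt0.
have LE : L x = phi x + dot lambda (f x) by [].
move: q1; rewrite ler_norml => /andP[+ _].
rewrite -/(L (x + t *: w')).
pose v := t^-1 *: (s - f x).
have sE : s = f x + t *: v.
  by rewrite scalerA divff ?gt_eqF// scale1r addrC subrK.
have [Bv|nBv] := ltP `|'d f x w - v| r.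
  have := AB (t, v) (conj At (Br _ Bv)).
  rewrite /= second_quotient_indic//; last by rewrite -sE.
  rewrite lte_fin ltr_pdivlMr//.
  have pen0 : 0 <= M / 2 * enorm (f (x + t *: w') - s) ^+ 2.
    by rewrite mulr_ge0 ?sqr_ge0// divr_ge0// ltW.
  have -> : dot lambda s = dot lambda (f x) + t * dot lambda v.
    by rewrite {1}sE dotDr dotZr.
  have eE : e = 4 * eta by rewrite /eta; field.
  rewrite eE; clearbody eta; lra.
(* Here [v] is at least [r] away from ['d f x w], and the first-order error uses up at most half of
   that. *)
have far : t * (r / 2) <= `|f (x + t *: w') - s|.
  have : t * r <= `|t *: ('d f x w - v)|.
    by rewrite normrZ gtr0_norm// ler_wpM2l// ltW.
  have -> : t *: ('d f x w - v) = (f (x + t *: w') - s) -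
      (f (x + t *: w') - f x - t *: 'd f x w).
    by rewrite sE; apply/rowP => i; rewrite !mxE; ring.
  move/le_trans => /(_ _ (ler_normB _ _)); lra.
have pen : M / 2 * (t * (r / 2)) ^+ 2
    <= M / 2 * enorm (f (x + t *: w') - s) ^+ 2.
  rewrite ler_wpM2l ?divr_ge0 ?(ltW M0)//.
  rewrite ler_pXn2r ?nnegrE ?enorm_ge0 ?(mulr_ge0 (ltW t0) (ltW r20))//.
  exact: le_trans far (norm_le_enorm _).
have {}M2 : (4 * eta - Q w) * (2^-1 * t ^+ 2) <= M / 2 * (t * (r / 2)) ^+ 2.
  rewrite [leRHS](_ : _ = M * (r / 2) ^+ 2 * (2^-1 * t ^+ 2)); last by ring.
  by rewrite ler_wpM2r ?(ltW t20)// -ler_pdivrMr ?exprn_gt0// ltW.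
clearbody eta; lra.
Unshelve. all: by end_near. Qed.

(** Compactness of the unit sphere gives one range of [t] and one parameter for all directions;
    monotonicity in [rho] does the rest. *)
Lemma aug_quadratic_growth :
  (forall w, w != 0 -> (0 < (Q w)%:E + d2Theta ('d f x w))%E) ->
  exists rhobar eps ell : R,
    [/\ 0 < rhobar, 0 < eps, 0 < ell &
      forall rho, rhobar <= rho -> forall z, eball x eps z ->
        phi x + ell / 2 * enorm (z - x) ^+ 2 <= aug rho z].
Proof.
move=> pos.
have /compact_near_coveringP := @compact_enorm_sphere R n.
move=> /(_ _ _ (fun i w =>
  phi x + i.2^-1 * i.1 ^+ 2 <= aug i.2 (x + i.1 *: w))).
move=> /(_ (filter_prod (0 : R)^'+ (pinfty_nbhs R)) _) [w /= w1|].
  by apply: near_aug_growth; apply: pos; rewrite -enorm_gt0 w1.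
move=> [A B] /= [[tau /= tau0 Atau] [M0 [_ BM0]]] AB.
pose M := Num.max M0 0 + 1.
have MM0 : M0 < M by rewrite ltr_pwDr// le_max lexx.
have M0' : 0 < M by rewrite ltr_pwDr// le_max lexx orbT.
(* [ell / 2] is the rate [M^-1] at parameter [M]; halving [tau] puts the closed ball inside the open
   range of [t]. *)
exists M, (tau / 2), (2 / M); split => // [||rho Mrho z]; rewrite ?divr_gt0//.
rewrite /eball/= => zx.
have rho0 : 0 < rho by exact: lt_le_trans Mrho.
have [->|zx0] := eqVneq z x.
  by rewrite /aug aug_lagrangian_multiplier// subrr sqr_enorm dot0l mulr0 addr0.
have t0 : 0 < enorm (z - x) by rewrite enorm_gt0 subr_eq0.
set t := enorm (z - x) in zx t0 *.
have -> : 2 / M / 2 = M^-1 by field; rewrite gt_eqF.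
have zE : z = x + t *: (t^-1 *: (z - x)).
  by rewrite scalerA divff ?gt_eqF// scale1r addrC subrK.
have T0 : Theta !=set0 by exists (f x); case: multiplier.
apply: le_trans (aug_lagrangian_mono phi f lambda z T0 M0' Mrho).
rewrite {1}zE; apply: (AB (t, M)) => /=; last first.
  by rewrite enormZ ger0_norm ?invr_ge0 ?ltW// mulVf ?gt_eqF.
split; last exact: BM0.
apply: Atau => //=; rewrite sub0r normrN gtr0_norm// (le_lt_trans zx)//.
by rewrite ltr_pdivrMr// ltr_pMr// ltr1n.
Qed.

(** Growth bounds the quotients at [u] below by [ell * enorm u ^+ 2], and [enorm u] stays above
    [enorm w / 2] near [w]. *)
Lemma growth_second_subderivative rho ell eps w :
  0 < rho -> 0 < eps -> 0 < ell ->
  (forall z, eball x eps z ->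
     phi x + ell / 2 * enorm (z - x) ^+ 2 <= aug rho z) ->
  w != 0 -> (0 < second_subderivative (fun z => (aug rho z)%:E) x 0 w)%E.
Proof.
move=> rho0 eps0 ell0 growth w0; have w1 : 0 < enorm w by rewrite enorm_gt0.
apply: (@lt_le_trans _ _ (ell * (enorm w / 2) ^+ 2)%:E).
  by rewrite lte_fin mulr_gt0// exprn_gt0// divr_gt0.
apply: le_second_subderivative.
have H1 := near_right_fst w (nbhs_right_gt (0 : R)).
have H2 : \forall u \near w, enorm w / 2 < enorm u.
  apply: (cvgr_gt _ (@enorm_continuous R n w)).
  by rewrite ltr_pdivrMr// ltr_pMr// ltr1n.
have {}H2 := near_right_snd H2.
have H3 : \forall d \near (0 : 'rV[R]_n), enorm d < eps.
  apply: (cvgr_lt _ (@enorm_continuous R n 0)).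
  by rewrite /enorm dot0l sqrtr0.
have {}H3 := near_right_scale w H3.
near=> p.
have t0 : 0 < p.1 by near: p; exact: H1.
have u1 : enorm w / 2 < enorm p.2 by near: p; exact: H2.
have tu : enorm (p.1 *: p.2) < eps by near: p; exact: H3.
move: p.1 p.2 t0 u1 tu => t u t0 u1 tu.
have t20 : 0 < 2^-1 * t ^+ 2 by rewrite mulr_gt0 ?invr_gt0// exprn_gt0.
rewrite /second_quotient dot0l mulr0 sube0 -EFinB -EFinM lee_fin.
rewrite {2}/aug aug_lagrangian_multiplier// ler_pdivlMr//.
have := growth (x + t *: u).
rewrite /eball/= addrAC subrr add0r => /(_ (ltW tu)).
rewrite enormZ gtr0_norm// exprMn => g.
rewrite lerBrDl (le_trans _ g)// lerD2l.
have -> : ell * (enorm w / 2) ^+ 2 * (2^-1 * t ^+ 2) =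
          ell / 2 * (t ^+ 2 * (enorm w / 2) ^+ 2) by ring.
rewrite ler_wpM2l ?divr_ge0 ?(ltW ell0)// ler_wpM2l ?sqr_ge0//.
by rewrite ler_pXn2r ?nnegrE ?divr_ge0 ?enorm_ge0// ltW.
Unshelve. all: by end_near. Qed.

End SecondOrderConditions.

Theorem theorem8p4 (R : realType) (n m : nat)
    (Theta : set 'rV[R]_m) (phi : 'rV[R]_n -> R) (f : 'rV[R]_n -> 'rV[R]_m)
    (xbar : 'rV[R]_n) (lambar : 'rV[R]_m)
    (Theta_closed : closed Theta)
    (Theta_convex : convex_set Theta)
    (phi_diff : twice_differentiable_fun phi xbar)
    (f_diff : twice_differentiable_map f xbar)
    (stationary : gradient (fun x => lagrangian phi f x lambar) xbar = 0)
    (multiplier : normal_cone Theta (f xbar) lambar)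
    (par_derivable : forall w, critical_cone Theta (f xbar) lambar w ->
       parabolically_derivable Theta (f xbar) w)
    (par_regular : parabolically_regular Theta (f xbar) lambar)
    (d2_continuous :
       {within domain (second_subderivative (indic_fun Theta) (f xbar) lambar),
        continuous (second_subderivative (indic_fun Theta) (f xbar) lambar)}) :
  let cond_i :=
    forall w : 'rV[R]_n, w != 0 ->
      critical_cone Theta (f xbar) lambar ('d f xbar w) ->
      (0 < (dot (w *m hessian (fun x => lagrangian phi f x lambar) xbar) w)%:E
           + second_subderivative (indic_fun Theta) (f xbar) lambar
               ('d f xbar w))%E in
  let cond_ii :=
    exists2 rhobar : R, 0 < rhobar &
      forall rho : R, rhobar < rho ->
      forall w : 'rV[R]_n, w != 0 ->
        (0 < second_subderivative
               (fun x => (aug_lagrangian phi f Theta x lambar rho)%:E)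
               xbar 0 w)%E in
  let cond_iii :=
    exists rhobar eps ell : R,
      [/\ 0 < rhobar, 0 < eps, 0 < ell &
        forall rho : R, rhobar <= rho ->
        forall x : 'rV[R]_n, eball xbar eps x ->
          aug_lagrangian phi f Theta x lambar rho
            >= phi xbar + ell / 2 * enorm (x - xbar) ^+ 2] in
  (cond_i <-> cond_ii) /\ (cond_ii <-> cond_iii).
Proof.
move=> cond_i cond_ii cond_iii.
have i_iii : cond_i -> cond_iii.
  move=> ci; apply: aug_quadratic_growth => // w w0.
  (* Condition (i) speaks only of the critical cone, which is the domain of the second
     subderivative; off it the sum is [+oo]. *)
  have [d2oo|] := boolP (second_subderivative (indic_fun Theta)
      (f xbar) lambar ('d f xbar w) < +oo)%E.
    by apply: ci => //; rewrite -domain_second_subderivative_indic.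
  by rewrite ltNge negbK leye_eq => /eqP ->; rewrite addey// ltry.
have iii_ii : cond_iii -> cond_ii.
  move=> [rhobar [eps [ell [rhobar0 eps0 ell0 growth]]]].
  exists rhobar => // rho rho_gt w w0.
  apply: (growth_second_subderivative multiplier _ eps0 ell0) => //.
    exact: lt_trans rho_gt.
  by apply: growth; exact: ltW.
have ii_i : cond_ii -> cond_i.
  move=> [rhobar rhobar0 pos] w w0 _.
  (* One admissible parameter suffices, since the bound obtained from it does not involve [rho]. *)
  have rho0 : 0 < rhobar + 1 by rewrite addr_gt0.
  have /lt_EFin_gap[c c0] := pos (rhobar + 1) (ltr_pwDr ltr01 (lexx _)) w w0.
  rewrite add0r.
  move=> /(lt_second_subderivative_aug phi_diff f_diff stationary multiplier rho0).
  by apply: lt_le_trans; rewrite lte_fin.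
by split; [split=> [/i_iii/iii_ii|/ii_i]|split=> [/ii_i/i_iii|/iii_ii]].
Qed.
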